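(* Let $R$ be a commutative noetherian ring, let $A$ be a DG $R$-algebra such that each $A_i$ is a free $R$-module of finite rank, let $t\in R$, and let $B=K^R(t)\otimes_RA$. Assume that $R$ is $tR$-adically complete. Let $N$ be a semi-free DG $B$-module whose semi-basis over $B$ is finite in each degree. If $\operatorname{Ext}^2_B(N,N)=0$, then $N$ is liftable to $A$ with a semi-free lifting; that is, there is a semi-free DG $A$-module $M$ with $N\cong B\otimes_AM$ as DG $B$-modules.
   Context: Complexes are indexed homologically. A (commutative) DG $R$-algebra is an $R$-complex $A$ with $A_i=0$ for $i<0$ and an associative, unital chain map $A\otimes_RA\to A$ that is graded commutative ($ab=(-1)^{|a||b|}ba$, $a^2=0$ for $|a|$ odd). $K^R(t)$ is the Koszul complex $0\to R\xrightarrow{t}R\to0$ (concentrated in degrees $1,0$) with its DG algebra structure; $B=K^R(t)\otimes_RA$ is a DG $R$-algebra with product $(x\otimes a)(x'\otimes a')=(-1)^{|a||x'|}(xx')\otimes(aa')$, and the natural map $A\to B$ is a morphism of DG algebras. A DG $A$-module is an $R$-complex $M$ with an associative, unital chain map $A\otimes_RM\to M$; $B\otimes_AM$ is a DG $B$-module via $b(b'\otimes m)=(bb')\otimes m$. A DG module $F$ is semi-free if $F_i=0$ for $i\ll0$ and the underlying graded module $\oplus_iF_i$ has a basis (a semi-basis) over the underlying graded algebra. $\operatorname{Hom}_B(M,N)_p$ consists of degree-$p$ $R$-linear maps $f$ with $f(bm)=(-1)^{p|b|}bf(m)$, with the usual Hom differential; for $M$ semi-free, $\operatorname{Ext}^i_B(M,N)=\operatorname{H}_{-i}(\operatorname{Hom}_B(M,N))$.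 *)

(* Defs.v *)
From HB Require Import structures.
From mathcomp Require Import all_boot all_order all_algebra.
Set Implicit Arguments. Unset Strict Implicit. Unset Printing Implicit Defensive.
Import GRing.Theory.
Local Open Scope ring_scope.

Section DG.
Variable R : comPzRingType.

Definition sgn (n : int) : R := (-1) ^+ (absz n).

Definition is_ideal (I : R -> Prop) : Prop :=
  [/\ I 0, (forall x y, I x -> I y -> I (x + y)) & (forall r x, I x -> I (r * x))].

Definition noetherian : Prop :=
  forall I : R -> Prop, is_ideal I ->
    exists s : seq R, forall x, I x <-> exists c : nat -> R, x = \sum_(k < size s) c k * s`_k.

Definition in_tpow (t : R) (n : nat) (r : R) : Prop := exists s : R, r = t ^+ n * s.

(* R -> lim_n R/t^n R is bijective: separated and complete *)
Definition t_adically_complete (t : R) : Prop :=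
  (forall r, (forall n, in_tpow t n r) -> r = 0) /\
  (forall u : nat -> R, (forall n, in_tpow t n (u n.+1 - u n)) ->
     exists r, forall n, in_tpow t n (r - u n)).

(* ---------- graded modules ----------
   A graded R-module is represented by its total module V = (+)_n V_n
   together with the family of projections pi n : V -> V onto V_n. *)
Definition grading (V : lmodType R) (pi : int -> V -> V) : Prop :=
  [/\ (forall n a u v, pi n (a *: u + v) = a *: pi n u + pi n v),
      (forall n m v, pi n (pi m v) = if n == m then pi m v else 0) &
      (forall v, exists s : seq int, uniq s /\ v = \sum_(n <- s) pi n v)].

Definition homog (V : lmodType R) (pi : int -> V -> V) (n : int) (v : V) : Prop :=
  pi n v = v.

Definition rlinear (V W : lmodType R) (f : V -> W) : Prop :=
  forall a u v, f (a *: u + v) = a *: f u + f v.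

Definition of_degree (V W : lmodType R) (piV : int -> V -> V) (piW : int -> W -> W)
  (p : int) (f : V -> W) : Prop :=
  forall n v, f (piV n v) = piW (n + p) (f v).

Definition is_sign_op (V : lmodType R) (pi : int -> V -> V) (sig : V -> V) : Prop :=
  rlinear sig /\ forall n v, sig (pi n v) = sgn n *: pi n v.

Definition is_dga (V : lmodType R) (pi : int -> V -> V) (mul : V -> V -> V)
  (one : V) (d : V -> V) : Prop :=
  grading pi /\
      (forall n v, n < 0 -> pi n v = 0) /\
      (forall a u v w, mul (a *: u + v) w = a *: mul u w + mul v w
                       /\ mul w (a *: u + v) = a *: mul w u + mul w v) /\
      (forall a b c, mul (mul a b) c = mul a (mul b c)) /\
      (homog pi 0 one /\ (forall a, mul one a = a /\ mul a one = a)) /\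
      (forall i j a b, homog pi i a -> homog pi j b -> homog pi (i + j) (mul a b)) /\
      (forall i j a b, homog pi i a -> homog pi j b -> mul a b = sgn (i * j) *: mul b a) /\
      (forall i a, homog pi i a -> odd (absz i) -> mul a a = 0) /\
      [/\ rlinear d, of_degree pi pi (-1) d & (forall v, d (d v) = 0)] /\
      (forall i a b, homog pi i a -> d (mul a b) = mul (d a) b + sgn i *: mul a (d b)).

Definition is_dgmod (VA : lmodType R) (piA : int -> VA -> VA) (mulA : VA -> VA -> VA)
  (oneA : VA) (dA : VA -> VA)
  (VM : lmodType R) (piM : int -> VM -> VM) (act : VA -> VM -> VM) (dM : VM -> VM) : Prop :=
  grading piM /\
      (forall r (a a' : VA) (m : VM), act (r *: a + a') m = r *: act a m + act a' m) /\
      (forall r (a : VA) (m m' : VM), act a (r *: m + m') = r *: act a m + act a m') /\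
      (forall a b m, act (mulA a b) m = act a (act b m)) /\
      (forall m, act oneA m = m) /\
      (forall i j a m, homog piA i a -> homog piM j m -> homog piM (i + j) (act a m)) /\
      [/\ rlinear dM, of_degree piM piM (-1) dM & (forall m, dM (dM m) = 0)] /\
      (forall i a m, homog piA i a -> dM (act a m) = act (dA a) m + sgn i *: act a (dM m)).

Definition semibasis (VA : lmodType R) (VM : lmodType R) (piM : int -> VM -> VM)
  (act : VA -> VM -> VM) (J : Type) (e : J -> VM) (deg : J -> int) : Prop :=
  [/\ injective e,
      (forall j, homog piM (deg j) (e j)),
      (forall m, exists (s : seq J) (c : J -> VA), m = \sum_(j <- s) act (c j) (e j)) &
      (forall (s : seq J) (c : J -> VA), uniq (map e s) ->
         \sum_(j <- s) act (c j) (e j) = 0 -> all (fun j => c j == 0) s)].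

Definition bounded_below (VM : lmodType R) (piM : int -> VM -> VM) : Prop :=
  exists n0 : int, forall n m, n < n0 -> piM n m = 0.

Definition semifree (VA : lmodType R) (VM : lmodType R) (piM : int -> VM -> VM)
  (act : VA -> VM -> VM) : Prop :=
  bounded_below piM /\
  exists (J : Type) (e : J -> VM) (deg : J -> int), semibasis piM act e deg.

Definition semifree_degfinite (VA : lmodType R) (VM : lmodType R) (piM : int -> VM -> VM)
  (act : VA -> VM -> VM) : Prop :=
  bounded_below piM /\
  exists (J : Type) (e : J -> VM) (deg : J -> int), semibasis piM act e deg /\
    forall n : int, exists s : seq VM, forall j, deg j = n -> e j \in s.

Definition hom_deg (VA : lmodType R) (piA : int -> VA -> VA)
  (VM : lmodType R) (piM : int -> VM -> VM) (act : VA -> VM -> VM)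
  (p : int) (f : VM -> VM) : Prop :=
  [/\ rlinear f, of_degree piM piM p f &
      forall i b m, homog piA i b -> f (act b m) = sgn (p * i) *: act b (f m)].

Definition hom_diff (VM : lmodType R) (dM : VM -> VM) (p : int) (f : VM -> VM) : VM -> VM :=
  fun m => dM (f m) - sgn p *: f (dM m).

(* Ext^i_B(M,M) = H_{-i}(Hom_B(M,M)) = 0 *)
Definition ext_vanishes (VA : lmodType R) (piA : int -> VA -> VA)
  (VM : lmodType R) (piM : int -> VM -> VM) (act : VA -> VM -> VM) (dM : VM -> VM)
  (i : int) : Prop :=
  forall f, hom_deg piA piM act (- i) f -> (forall m, hom_diff dM (- i) f m = 0) ->
    exists g, hom_deg piA piM act (- i + 1) g /\ forall m, f m = hom_diff dM (- i + 1) g m.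

(* ---------- B = K^R(t) (x)_R A ----------
   K^R(t) is free over R on 1 (degree 0) and x (degree 1), x^2 = 0, dx = t.
   An element 1(x)a0 + x(x)a1 of B is encoded as the pair (a0, a1). *)
Section Koszul.
Variables (t : R) (VA : lmodType R) (piA : int -> VA -> VA) (mulA : VA -> VA -> VA)
  (oneA : VA) (dA : VA -> VA) (sigA : VA -> VA).

Definition piB (n : int) (b : VA * VA) : VA * VA := (piA n b.1, piA (n - 1) b.2).
(* (1(x)a0 + x(x)a1)(1(x)a0' + x(x)a1') = 1(x)a0a0' + x(x)((-1)^|a0| a0 a1' + a1 a0') *)
Definition mulB (b b' : VA * VA) : VA * VA :=
  (mulA b.1 b'.1, mulA (sigA b.1) b'.2 + mulA b.2 b'.1).
Definition oneB : VA * VA := (oneA, 0).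
(* d(1(x)a0 + x(x)a1) = 1(x)(d a0 + t a1) - x(x) d a1 *)
Definition dB (b : VA * VA) : VA * VA := (dA b.1 + t *: b.2, - dA b.2).

(* B (x)_A M = K^R(t) (x)_R M; (m0, m1) encodes (1(x)1)(x)m0 + (x(x)1)(x)m1 *)
Variables (VM : lmodType R) (piM : int -> VM -> VM) (actM : VA -> VM -> VM) (dM : VM -> VM).
Definition piBM (n : int) (v : VM * VM) : VM * VM := (piM n v.1, piM (n - 1) v.2).
Definition actBM (b : VA * VA) (v : VM * VM) : VM * VM :=
  (actM b.1 v.1, actM (sigA b.1) v.2 + actM b.2 v.1).
Definition dBM (v : VM * VM) : VM * VM := (dM v.1 + t *: v.2, - dM v.2).
End Koszul.

Definition dg_iso (VB : lmodType R) (VN : lmodType R) (piN : int -> VN -> VN)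
  (actN : VB -> VN -> VN) (dN : VN -> VN)
  (VP : lmodType R) (piP : int -> VP -> VP) (actP : VB -> VP -> VP) (dP : VP -> VP)
  (phi : VN -> VP) : Prop :=
  [/\ rlinear phi, bijective phi, of_degree piN piP 0 phi,
      (forall v, phi (dN v) = dP (phi v)) &
      (forall b v, phi (actN b v) = actP b (phi v))].

Definition free_finite_rank (V : lmodType R) (P : V -> Prop) : Prop :=
  exists s : seq V, (forall k, (k < size s)%N -> P s`_k) /\
    (forall v, P v -> exists c : nat -> R, v = \sum_(k < size s) c k *: s`_k) /\
    (forall c : nat -> R, \sum_(k < size s) c k *: s`_k = 0 ->
        forall k, (k < size s)%N -> c k = 0).

End DG.

(* Main.v *)
Require Import Defs.
From HB Require Import structures.
From mathcomp Require Import all_boot all_order all_algebra.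
From Stdlib Require Import IndefiniteDescription.
From mathcomp Require Import ring zify.
Set Implicit Arguments. Unset Strict Implicit. Unset Printing Implicit Defensive.
Import Order.TTheory GRing.Theory.
Local Open Scope ring_scope.

(* Let M be the A-span of the semi-basis, so that N = M + xM.  The differential
   of N is determined by  m |-> alpha m + x (beta m)  on M, where alpha is an
   A-derivation of degree -1, beta is A-linear of degree -2, alpha and beta
   commute and alpha^2 = - t beta.  For an A-semilinear Gamma of degree -1 the
   change of basis m |-> m + x (Gamma m) replaces alpha by alpha + t Gamma and
   beta by  beta - alpha Gamma - Gamma alpha - t Gamma^2,  so it suffices to
   make the latter zero: then (M, alpha + t Gamma) is the lifting.  Gamma is the
   t-adic limit of partial solutions G_n with error t^n b_n.  The error b_n
   commutes with the sheared differential, so it is a cycle of degree -2 in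
   Hom_B(N, N) (even though t may be a zero divisor); a bounding homotopy
   m |-> g m + x (delta m) says
   b_n = alpha_n g + g alpha_n + t delta  with  alpha_n = alpha + t G_n,
   and G_(n+1) = G_n + t^n g has error t^(n+1) (delta - t^n g^2).  The limit
   exists because each M_i is finitely generated over R. *)

(** * Linear and graded preliminaries *)

(* An identity between R-linear combinations in V is checked by [ring] in the
   square-zero extension of R by V; the factor [int] makes that ring nonzero. *)
Section TrivialExtension.
Variables (R : comPzRingType) (V : lmodType R).

Definition triv_ext : Type := (int * (R * V))%type.
HB.instance Definition _ := GRing.Zmodule.on triv_ext.

Definition triv_one : triv_ext := (1, (1, 0)).
Definition triv_mul (a b : triv_ext) : triv_ext :=
  (a.1 * b.1, (a.2.1 * b.2.1, a.2.1 *: b.2.2 + b.2.1 *: a.2.2)).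

Lemma triv_mulA : associative triv_mul.
Proof.
move=> [m [r u]] [n [s v]] [p [q w]]; rewrite /triv_mul /= !mulrA.
by rewrite !scalerDr !scalerA addrA (mulrC q r) (mulrC q s).
Qed.
Lemma triv_mulC : commutative triv_mul.
Proof.
move=> [m [r u]] [n [s v]]; rewrite /triv_mul /=.
by rewrite (mulrC m) (mulrC r) addrC.
Qed.
Lemma triv_mul1 : left_id triv_one triv_mul.
Proof.
move=> [m [r u]]; rewrite /triv_mul /=.
by rewrite !mul1r scale1r scaler0 addr0.
Qed.
Lemma triv_mulDl : left_distributive triv_mul +%R.
Proof.
move=> [m [r u]] [n [s v]] [p [q w]].
rewrite /triv_mul /= !mulrDl scalerDl scalerDr.
by congr (_, (_, _)); rewrite addrACA.
Qed.
Lemma triv_one_neq0 : triv_one != 0.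
Proof. by apply/eqP => - []. Qed.
HB.instance Definition _ := GRing.Zmodule_isComNzRing.Build triv_ext
  triv_mulA triv_mulC triv_mul1 triv_mulDl triv_one_neq0.

Definition tv (v : V) : triv_ext := (0, (0, v)).
Definition ts (r : R) : triv_ext := (0, (r, 0)).

Lemma tv_inj : injective tv. Proof. by move=> u v []. Qed.
Lemma tvD u v : tv (u + v) = tv u + tv v.
Proof. by rewrite /tv; congr (_, (_, _)); rewrite addr0. Qed.
Lemma tvN u : tv (- u) = - tv u.
Proof. by rewrite /tv; congr (_, (_, _)); rewrite oppr0. Qed.
Lemma tv0 : tv 0 = 0. Proof. by []. Qed.
Lemma tsM r s : ts (r * s) = ts r * ts s.
Proof. by rewrite /ts; congr (_, (_, _)); rewrite !scaler0 addr0. Qed.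
Lemma tvZ r u : tv (r *: u) = ts r * tv u.
Proof. by rewrite /tv /ts; congr (_, (_, _)); rewrite /= ?scale0r ?addr0 ?mulr0 . Qed.
Definition tvE := (tvD, tvN, tvZ, tv0, tsM).
End TrivialExtension.

(** The map [ts] is multiplicative but not unital, so powers of t stay atoms for [ring]; [exprS]
    first exposes t^(n+1) as t times t^n. *)
Ltac lmod := apply: tv_inj; rewrite ?exprS ?tvE; ring.

Section LinearMaps.
Variables (R : comPzRingType) (V W : lmodType R) (f : V -> W).
Hypothesis fl : rlinear f.

Lemma rlinD u v : f (u + v) = f u + f v.
Proof. by have := fl 1 u v; rewrite !scale1r. Qed.

Lemma rlin0 : f 0 = 0.
Proof. by have := fl (-1) 0 0; rewrite scaler0 addr0 scaleN1r addNr. Qed.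

Lemma rlinZ a u : f (a *: u) = a *: f u.
Proof. by have := fl a u 0; rewrite rlin0 !addr0. Qed.

Lemma rlinN u : f (- u) = - f u.
Proof. by rewrite -!scaleN1r rlinZ. Qed.

Lemma rlin_sum (I : Type) (s : seq I) (F : I -> V) :
  f (\sum_(i <- s) F i) = \sum_(i <- s) f (F i).
Proof. exact: (big_morph f rlinD rlin0). Qed.

Definition rlinE := (rlinD, rlinN, rlinZ, rlin0).
End LinearMaps.

Lemma rlinear_comp (R : comPzRingType) (U V W : lmodType R) (g : V -> W) (f : U -> V) :
  rlinear g -> rlinear f -> rlinear (g \o f).
Proof. by move=> gl fl a u v /=; rewrite fl gl. Qed.

Section Signs.
Variable R : comPzRingType.

Lemma sgnN i : sgn R (- i) = sgn R i.
Proof. by rewrite /sgn abszN. Qed.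

Lemma sgnK i : sgn R i * sgn R i = 1.
Proof. by rewrite /sgn -expr2 sqrr_sign. Qed.

Lemma sgn1 : sgn R 1 = -1. Proof. by []. Qed.

Lemma sgn_even i : sgn R (- 2 * i) = 1.
Proof. by rewrite /sgn abszM (_ : absz (- 2) = 2%N) // exprM sqrrN !expr1n. Qed.
End Signs.

Section Gradings.
Variables (R : comPzRingType) (V : lmodType R) (pi : int -> V -> V).
Hypothesis gr : grading pi.

Lemma pi_lin n : rlinear (pi n).
Proof. by case: gr => H _ _; apply: H. Qed.

Lemma pi_pi n m v : pi n (pi m v) = if n == m then pi m v else 0.
Proof. by case: gr. Qed.

Lemma homog_pi n v : homog pi n (pi n v).
Proof. by rewrite /homog pi_pi eqxx. Qed.

Lemma pi_homog n m v : homog pi m v -> pi n v = if n == m then v else 0.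
Proof. by move=> h; rewrite -{1}h pi_pi h. Qed.

Lemma pi_sum v : exists s : seq int, v = \sum_(n <- s) pi n v.
Proof. by case: gr => _ _ /(_ v) [s [_ e]]; exists s. Qed.

(** Sign rules and Leibniz rules are given on homogeneous elements only; this extends their linear
    consequences to all elements. *)
Lemma grading_ext (W : lmodType R) (f g : V -> W) : rlinear f -> rlinear g ->
  (forall n v, homog pi n v -> f v = g v) -> forall v, f v = g v.
Proof.
move=> fl gl e v; have [s ->] := pi_sum v.
rewrite (rlin_sum fl) (rlin_sum gl); apply: eq_bigr => n _.
by apply: (e n); apply: homog_pi.
Qed.

Lemma pi_eq0 v : (forall n, pi n v = 0) -> v = 0.
Proof. by move=> e; have [s ->] := pi_sum v; apply: big1 => n _. Qed.
End Gradings.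

(** * Transport of endomorphisms and of Ext along DG isomorphisms *)

Section Conjugation.
Variables (R : comPzRingType) (VB : lmodType R) (piB : int -> VB -> VB).
Variables (VN : lmodType R) (piN : int -> VN -> VN) (actN : VB -> VN -> VN) (dN : VN -> VN).
Variables (VP : lmodType R) (piP : int -> VP -> VP) (actP : VB -> VP -> VP) (dP : VP -> VP).
Variables (phi : VN -> VP) (psi : VP -> VN).
Hypotheses (phiK : cancel phi psi) (psiK : cancel psi phi).
Hypothesis iso : dg_iso piN actN dN piP actP dP phi.

Lemma dg_iso_inv : dg_iso piP actP dP piN actN dN psi.
Proof.
have [fl _ fd fc fa] := iso.
have inj := can_inj phiK; split.
- by move=> a u v; apply: inj; rewrite fl !psiK.
- by exists phi.
- by move=> n v; apply: inj; rewrite psiK fd addr0 addr0 psiK.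
- by move=> v; apply: inj; rewrite psiK fc psiK.
- by move=> b v; apply: inj; rewrite psiK fa psiK.
Qed.

Lemma hom_deg_conj p f :
  hom_deg piB piN actN p f -> hom_deg piB piP actP p (phi \o f \o psi).
Proof.
have [fl _ fd fc fa] := iso; have [gl _ gd gc ga] := dg_iso_inv.
case=> hl hd ha; split.
- by do 2!apply: rlinear_comp => //.
- by move=> n v /=; rewrite gd hd fd !addr0.
- by move=> i b m hb /=; rewrite ga (ha i) // (rlinZ fl) fa.
Qed.

Lemma hom_diff_conj p f m :
  hom_diff dP p (phi \o f \o psi) m = phi (hom_diff dN p f (psi m)).
Proof.
have [fl _ fd fc fa] := iso; have [gl _ gd gc ga] := dg_iso_inv.
by rewrite /hom_diff /= !(rlinE fl) fc gc.
Qed.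
End Conjugation.

(** Conjugation by [phi] is an isomorphism of Hom complexes, so cycles are pulled back and bounding
    homotopies pushed forward. *)
Lemma ext_vanishes_iso (R : comPzRingType) (VB : lmodType R) (piB : int -> VB -> VB)
  (VN : lmodType R) (piN : int -> VN -> VN) (actN : VB -> VN -> VN) (dN : VN -> VN)
  (VP : lmodType R) (piP : int -> VP -> VP) (actP : VB -> VP -> VP) (dP : VP -> VP)
  (phi : VN -> VP) (i : int) :
  dg_iso piN actN dN piP actP dP phi ->
  ext_vanishes piB piN actN dN i -> ext_vanishes piB piP actP dP i.
Proof.
move=> iso ext f fdeg fcyc; have [fl [psi phiK psiK] _ _ _] := iso.
have inv := dg_iso_inv phiK psiK iso.
have [||g [gdeg ge]] := ext (psi \o f \o phi).
- exact: hom_deg_conj inv _ _ fdeg.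
- by move=> m; rewrite (hom_diff_conj psiK phiK inv) fcyc; case: inv => h *; apply: rlin0.
exists (phi \o g \o psi); split; first exact: hom_deg_conj iso _ _ gdeg.
by move=> m; rewrite (hom_diff_conj phiK psiK iso) -ge /= !psiK.
Qed.

Lemma dependent_choice_seq (T : Type) (P : nat -> T -> Prop) (Q : nat -> T -> T -> Prop) x0 :
  P 0%N x0 -> (forall n x, P n x -> exists y, Q n x y /\ P n.+1 y) ->
  exists u : nat -> T, forall n, P n (u n) /\ Q n (u n) (u n.+1).
Proof.
move=> P0 PS.
have step n (x : {x | P n x}) : {y : {y | P n.+1 y} | Q n (sval x) (sval y)}.
  have [y [Qy Py]] := constructive_indefinite_description _ (PS n _ (svalP x)).
  by exists (exist _ y Py).
pose v := fix v n : {x | P n x} :=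
  if n is n'.+1 then sval (step n' (v n')) else exist _ x0 P0.
exists (fun n => sval (v n)) => n; split; first exact: (svalP (v n)).
exact: (svalP (step n (v n))).
Qed.

(** * Adic limits *)

Section Adic.
Variables (R : comPzRingType) (t : R) (V : lmodType R).

Definition t_limit (u : nat -> V) (l : V) : Prop :=
  forall n, exists z, l - u n = t ^+ n *: z.

Definition t_separated : Prop :=
  forall v : V, (forall n, exists z, v = t ^+ n *: z) -> v = 0.

(** A Cauchy sequence comes with explicit increments t^n w_n; only the w_n are constrained to P,
    neither the terms nor the limit. *)
Definition t_complete_on (P : V -> Prop) : Prop :=
  forall u w : nat -> V, (forall n, P (w n)) ->
    (forall n, u n.+1 = u n + t ^+ n *: w n) -> exists l, t_limit u l.

Lemma t_limit_unique u l l' : t_separated -> t_limit u l -> t_limit u l' -> l = l'.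
Proof.
move=> sep ul ul'; apply/eqP; rewrite -subr_eq0; apply/eqP/sep => n.
have [z e] := ul n; have [z' e'] := ul' n; exists (z - z').
by rewrite scalerBr -e -e' opprB addrA subrK.
Qed.
End Adic.

Lemma t_limit_lin (R : comPzRingType) (t : R) (V W : lmodType R) (f : V -> W) u l :
  rlinear f -> t_limit t u l -> t_limit t (f \o u) (f l).
Proof.
move=> fl ul n; have [z e] := ul n; exists (f z).
by rewrite /= -(rlinN fl) -(rlinD fl) e (rlinZ fl).
Qed.

Lemma t_limitD (R : comPzRingType) (t : R) (V : lmodType R) (u u' : nat -> V) l l' a :
  t_limit t u l -> t_limit t u' l' -> t_limit t (fun n => a *: u n + u' n) (a *: l + l').
Proof.
move=> ul ul' n; have [z e] := ul n; have [z' e'] := ul' n; exists (a *: z + z').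
have -> : a *: l + l' - (a *: u n + u' n) = a *: (l - u n) + (l' - u' n) by lmod.
by rewrite e e'; lmod.
Qed.

(** * Maps on M + xM *)

Section DGAlgebra.
Variables (R : comPzRingType) (VA : lmodType R) (piA : int -> VA -> VA).
Variables (mulA : VA -> VA -> VA) (oneA : VA) (dA sigA : VA -> VA).
Hypotheses (dga : is_dga piA mulA oneA dA) (sgA : is_sign_op piA sigA).

Lemma dga_grading : grading piA. Proof. by case: dga. Qed.

Lemma dga_dlin : rlinear dA.
Proof. by case: dga => _ [_ [_ [_ [_ [_ [_ [_ [[]]]]]]]]]. Qed.

Lemma dga_d_homog i a : homog piA i a -> homog piA (i - 1) (dA a).
Proof.
case: dga => _ [_ [_ [_ [_ [_ [_ [_ [[_ d _] _]]]]]]]] ha.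
by rewrite /homog -d ha.
Qed.

Lemma sign_lin : rlinear sigA. Proof. by case: sgA. Qed.

Lemma sign_homog i a : homog piA i a -> sigA a = sgn R i *: a.
Proof. by case: sgA => _ H ha; rewrite -ha H. Qed.

Lemma signK : involutive sigA.
Proof.
have sl := sign_lin; apply: (grading_ext dga_grading (f := sigA \o sigA) (g := id)) => //.
- exact: rlinear_comp.
- by move=> i a ha; rewrite /= !(sign_homog ha, rlinZ sl) scalerA sgnK scale1r.
Qed.

Lemma dga_mulDr a b c : mulA a (b + c) = mulA a b + mulA a c.
Proof.
by case: dga => _ [_ [/(_ 1 b c a) [_]]] + _; rewrite !scale1r.
Qed.

Lemma dga_mulDl a b c : mulA (b + c) a = mulA b a + mulA c a.
Proof.
by case: dga => _ [_ [/(_ 1 b c a) []]] + _ _; rewrite !scale1r.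
Qed.

Lemma dga_mul0r a : mulA a 0 = 0.
Proof. by apply: (addrI (mulA a 0)); rewrite -dga_mulDr !addr0. Qed.

Lemma dga_mul0l a : mulA 0 a = 0.
Proof. by apply: (addrI (mulA 0 a)); rewrite -dga_mulDl !addr0. Qed.

Lemma dga_mul1r a : mulA a oneA = a.
Proof. by case: dga => _ [_ [_ [_ [[_ /(_ a) []]]]]]. Qed.

Lemma dga_mul1l a : mulA oneA a = a.
Proof. by case: dga => _ [_ [_ [_ [[_ /(_ a) []]]]]]. Qed.

Lemma dga_one : homog piA 0 oneA.
Proof. by case: dga => _ [_ [_ [_ [[]]]]]. Qed.
End DGAlgebra.

(** A DG module stripped of its differential: the span M of the semi-basis inherits only this much
    from N, since the differential of N need not preserve M. *)
Definition is_gmod (R : comPzRingType) (VA : lmodType R) (piA : int -> VA -> VA)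
  (mulA : VA -> VA -> VA) (oneA : VA)
  (VM : lmodType R) (piM : int -> VM -> VM) (act : VA -> VM -> VM) : Prop :=
  [/\ grading piM,
      (forall r a a' m, act (r *: a + a') m = r *: act a m + act a' m),
      (forall r a m m', act a (r *: m + m') = r *: act a m + act a m'),
      (forall a b m, act (mulA a b) m = act a (act b m)) &
      (forall m, act oneA m = m) /\
      (forall i j a m, homog piA i a -> homog piM j m -> homog piM (i + j) (act a m))].

Section GradedModule.
Variables (R : comPzRingType) (VA : lmodType R) (piA : int -> VA -> VA).
Variables (mulA : VA -> VA -> VA) (oneA : VA).
Hypothesis grA : grading piA.
Variables (VM : lmodType R) (piM : int -> VM -> VM) (act : VA -> VM -> VM).
Hypothesis gm : is_gmod piA mulA oneA piM act.

Lemma gmod_grading : grading piM. Proof. by case: gm. Qed.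

Lemma act_linl m : rlinear (act^~ m).
Proof. by case: gm => _ H _ _ _ r a a'; apply: H. Qed.

Lemma act_linr a : rlinear (act a).
Proof. by case: gm => _ _ H _ _ r m m'; apply: H. Qed.

Lemma act_mul a b m : act (mulA a b) m = act a (act b m).
Proof. by case: gm. Qed.

Lemma act_one m : act oneA m = m.
Proof. by case: gm => _ _ _ _ []. Qed.

Lemma act_homog i j a m :
  homog piA i a -> homog piM j m -> homog piM (i + j) (act a m).
Proof. by case: gm => _ _ _ _ [_]; apply. Qed.

Lemma pi_act n k a m : homog piM k m -> piM n (act a m) = act (piA (n - k) a) m.
Proof.
move=> hm; have gr := gmod_grading.
apply: (grading_ext grA (f := piM n \o act^~ m) (g := act^~ m \o piA (n - k))).
- by apply: rlinear_comp; [apply: pi_lin | apply: act_linl].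
- by apply: rlinear_comp; [apply: act_linl | apply: pi_lin].
move=> i b hb /=; rewrite (pi_homog gr _ (act_homog hb hm)) (pi_homog grA _ hb).
rewrite subr_eq; case: eqP => // _; by rewrite (rlin0 (act_linl m)).
Qed.
End GradedModule.

Section KoszulMaps.
Variables (R : comPzRingType) (t : R) (VA : lmodType R) (piA : int -> VA -> VA).
Variables (mulA : VA -> VA -> VA) (oneA : VA) (dA sigA : VA -> VA).
Hypotheses (dga : is_dga piA mulA oneA dA) (sgA : is_sign_op piA sigA).
Variables (VM : lmodType R) (piM : int -> VM -> VM) (act : VA -> VM -> VM).
Hypothesis gm : is_gmod piA mulA oneA piM act.

Let grA := dga_grading dga.
Let grM := gmod_grading gm.
Let actl m := act_linl gm m.
Let actr a := act_linr gm a.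

(** Even and odd maps are the elements of Hom_A(M, M) of degrees -2 and -1. The Koszul sign is
    absorbed into [sigA], so the laws can be stated for all a in A. *)
Definition even_map (b : VM -> VM) : Prop :=
  [/\ rlinear b, of_degree piM piM (- 2) b & forall a m, b (act a m) = act a (b m)].
Definition odd_map (g : VM -> VM) : Prop :=
  [/\ rlinear g, of_degree piM piM (- 1) g & forall a m, g (act a m) = act (sigA a) (g m)].
Definition derivation_map (alpha : VM -> VM) : Prop :=
  [/\ rlinear alpha, of_degree piM piM (- 1) alpha &
      forall a m, alpha (act a m) = act (dA a) m + act (sigA a) (alpha m)].

(* The pair (m0, m1) stands for m0 + x m1; a Leibniz differential on M + xM
   is determined by its restriction m |-> alpha m + x (beta m) to M. *)
Definition koszul_diff (alpha beta : VM -> VM) (v : VM * VM) : VM * VM :=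
  (alpha v.1 + t *: v.2, beta v.1 - alpha v.2).

Let piP := piBM piM.
Let actP := actBM sigA act.

Lemma homog_inl i a : homog piA i a -> homog (piB piA) i (a, 0).
Proof.
by move=> ha; rewrite /homog /piB /= ha (rlin0 (pi_lin grA _)).
Qed.

Lemma homog_x : homog (piB piA) 1 (0, oneA).
Proof.
by rewrite /homog /piB /= (rlin0 (pi_lin grA _)) subrr (dga_one dga).
Qed.

Lemma actBM_inl a m0 m1 : actP (a, 0) (m0, m1) = (act a m0, act (sigA a) m1).
Proof. by rewrite /actP /actBM /= (rlin0 (actl _)) addr0. Qed.

Lemma actBM_x m0 m1 : actP (0, oneA) (m0, m1) = (0, m0).
Proof.
by rewrite /actP /actBM /= (rlin0 (sign_lin sgA)) !(rlin0 (actl _)) (act_one gm) add0r.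
Qed.

Lemma even_map_hom_deg b : even_map b ->
  hom_deg (piB piA) piP actP (- 2) (fun v => (b v.1, b v.2)).
Proof.
case=> bl bd ba; split.
- by move=> c [u u'] [v v'] /=; rewrite !bl.
- move=> n [u v]; rewrite /piP /piBM /= !bd.
  by congr (_, piM _ _); lia.
- move=> i [a0 a1] [m0 m1] _; rewrite sgn_even scale1r /actP /actBM /=.
  by rewrite (rlinD bl) !ba.
Qed.

(** Such a g is determined by its restriction m |-> gamma m + x (delta m) to M: since g(x m) = - x
    g(m) and x^2 = 0, only - x (gamma m) survives on xM. *)
Lemma hom_deg_components g : hom_deg (piB piA) piP actP (- 2 + 1) g ->
  exists gamma delta, [/\ odd_map gamma, even_map delta &
    forall m0 m1, g (m0, m1) = (gamma m0, delta m0 - gamma m1)].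
Proof.
case=> gl gd ga; exists (fun m => (g (m, 0)).1), (fun m => (g (m, 0)).2).
have inl_lin : rlinear (fun m : VM => (m, 0 : VM)).
  by move=> c u v; congr (_, _); rewrite /= scaler0 addr0.
have glin : rlinear (fun m => g (m, 0)) by apply: (rlinear_comp gl inl_lin).
have gdeg n m : g (piM n m, 0) = piP (n + (- 2 + 1)) (g (m, 0)).
  by rewrite -gd /piP /piBM /= (rlin0 (pi_lin grM _)).
have gact a m : g (act a m, 0) = (act (sigA a) (g (m, 0)).1, act a (g (m, 0)).2).
  have L (c : VA -> VA) (u : VM) : rlinear c -> rlinear (act^~ u \o c).
    by move=> cl; apply: rlinear_comp.
  have sl := sign_lin sgA; have idl : rlinear (@id VA) by [].
  move: a; apply: (grading_ext grA (f := fun a => g (act a m, 0))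
     (g := fun a => (act (sigA a) (g (m, 0)).1, act a (g (m, 0)).2))).
  - exact: (rlinear_comp glin (actl m)).
  - move=> c a a' /=; congr (_, _).
      exact: (L sigA _ sl c a a').
    exact: (actl _ c a a').
  move=> i a ha.
  have := ga i (a, 0) (m, 0) (homog_inl ha).
  rewrite actBM_inl (rlin0 (actr _)) => ->.
  case: (g (m, 0)) => u v; rewrite actBM_inl (sign_homog sgA ha).
  rewrite mulN1r sgnN !(rlinZ (actl _)); congr (_, _).
  by rewrite /= scalerA sgnK scale1r.
split.
- split.
  + by move=> c u v; rewrite glin.
  + by move=> n m; rewrite gdeg.
  + by move=> a m; rewrite gact.
- split.
  + by move=> c u v; rewrite glin.
  + move=> n m; rewrite gdeg /piP /piBM /=.
    by congr (piM _ _); lia.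
  + by move=> a m; rewrite gact.
move=> m0 m1.
have -> : (m0, m1) = (m0, 0) + actP (0, oneA) (m1, 0).
  by rewrite actBM_x; congr (_, _); rewrite ?addr0 ?add0r.
rewrite (rlinD gl) (ga 1 _ _ homog_x).
case: (g (m0, 0)) (g (m1, 0)) => u v [u' v'] /=; rewrite actBM_x.
congr (_, _) => /=; first by rewrite scaler0 addr0.
by rewrite (_ : sgn R _ = -1) // scaleN1r.
Qed.

(** Commuting with both alpha and beta makes the B-linear extension of b a cycle of degree -2. The
    two resulting equations are the M- and xM-components, on M, of the identity expressing it as a
    boundary. *)
Lemma ext_vanishes_components alpha beta : derivation_map alpha -> even_map beta ->
  ext_vanishes (piB piA) piP actP (koszul_diff alpha beta) 2 ->
  forall b, even_map b -> (forall m, alpha (b m) = b (alpha m)) ->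
    (forall m, beta (b m) = b (beta m)) ->
  exists gamma delta, [/\ odd_map gamma, even_map delta,
    (forall m, b m = alpha (gamma m) + gamma (alpha m) + t *: delta m) &
    (forall m, beta (gamma m) - gamma (beta m) = alpha (delta m) - delta (alpha m))].
Proof.
case=> al ad aa [bl bd ba] ext b evb comA comB.
have [bl' _ _] := evb.
have [|g [gdeg ge]] := ext _ (even_map_hom_deg evb).
  move=> [m0 m1]; rewrite /hom_diff /koszul_diff /= !(rlinE bl') comA comA comB.
  by rewrite (_ : sgn R _ = 1) ?scale1r ?subrr //; exact: sgn_even 1.
have [gamma [delta [og ed gE]]] := hom_deg_components gdeg.
exists gamma, delta.
have E m : (b m, 0) = (alpha (gamma m) + gamma (alpha m) + t *: delta m,
   (beta (gamma m) - gamma (beta m)) - (alpha (delta m) - delta (alpha m))).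
  have [gl _ _] := og; have [dl _ _] := ed.
  have := ge (m, 0); rewrite /= (rlin0 bl') => ->.
  rewrite /hom_diff gE /koszul_diff /= gE /= !(rlin0 gl, rlin0 al, oppr0, scaler0, addr0).
  by rewrite scaleN1r; congr (_, _) => /=; lmod.
split=> // m.
  by case: (E m).
by case: (E m) => _ /eqP; rewrite eq_sym subr_eq0 => /eqP.
Qed.

(** The isomorphism sends m + x (Gamma m) to m, making the graph of Gamma the new copy of M. The
    twist by [sigA] in the law of Gamma is what makes it B-linear. *)
Lemma shear_iso alpha beta alpha' beta' Gamma :
  odd_map Gamma ->
  (forall m, alpha' m = alpha m + t *: Gamma m) ->
  rlinear alpha ->
  (forall m, beta' m =
     beta m - alpha (Gamma m) - Gamma (alpha m) - t *: Gamma (Gamma m)) ->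
  dg_iso piP actP (koszul_diff alpha beta) piP actP (koszul_diff alpha' beta')
    (fun v => (v.1, v.2 - Gamma v.1)).
Proof.
move=> [gl gd ga] aE al bE; split.
- move=> c [u u'] [v v'] /=; congr (_, _).
  by rewrite /= !(rlinE gl); lmod.
- exists (fun v : VM * VM => (v.1, v.2 + Gamma v.1)).
  + by move=> [u v] /=; rewrite subrK.
  + by move=> [u v] /=; rewrite addrK.
- move=> n [u v]; rewrite /piP /piBM /= addr0 gd.
  by rewrite (rlinD (pi_lin grM _)) (rlinN (pi_lin grM _)).
- move=> [u v]; rewrite /koszul_diff /= !aE !bE !(rlinE gl, rlinE al).
  by congr (_, _); lmod.
- move=> [a0 a1] [u v]; rewrite /actP /actBM /=.
  by rewrite ga (rlinD (actr _)) (rlinN (actr _)); congr (_, _); lmod.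
Qed.

Lemma odd_map_addZ G g r : odd_map G -> odd_map g -> odd_map (fun m => G m + r *: g m).
Proof.
move=> [Gl Gd Ga] [gl gd ga]; split.
- by move=> c u v; rewrite !(rlinE Gl, rlinE gl); lmod.
- by move=> n m; rewrite Gd gd (rlinD (pi_lin grM _)) (rlinZ (pi_lin grM _)).
- by move=> a m; rewrite Ga ga (rlinD (actr _)) (rlinZ (actr _)).
Qed.

(** The square of an odd map is A-linear because [sigA] is an involution. *)
Lemma even_map_subZ_sqr d g r : even_map d -> odd_map g ->
  even_map (fun m => d m - r *: g (g m)).
Proof.
move=> [dl dd da] [gl gd ga]; split.
- by move=> c u v; rewrite !(rlinE dl, rlinE gl); lmod.
- move=> n m; rewrite dd !gd -addrA.
  by rewrite (rlinD (pi_lin grM _)) (rlinN (pi_lin grM _)) (rlinZ (pi_lin grM _)).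
- move=> a m; rewrite da !ga (signK dga sgA).
  by rewrite (rlinD (actr _)) (rlinN (actr _)) (rlinZ (actr _)).
Qed.

Lemma derivation_map_addZ alpha g r : derivation_map alpha -> odd_map g ->
  derivation_map (fun m => alpha m + r *: g m).
Proof.
move=> [al ad aa] [gl gd ga]; split.
- by move=> c u v; rewrite !(rlinE al, rlinE gl); lmod.
- by move=> n m; rewrite ad gd (rlinD (pi_lin grM _)) (rlinZ (pi_lin grM _)).
- by move=> a m; rewrite aa ga (rlinD (actr _)) (rlinZ (actr _)) addrA.
Qed.

Lemma even_mapZ b r : even_map b -> even_map (fun m => r *: b m).
Proof.
move=> [bl bd ba]; split.
- by move=> c u v; rewrite !(rlinE bl); lmod.
- by move=> n m; rewrite bd (rlinZ (pi_lin grM _)).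
- by move=> a m; rewrite ba (rlinZ (actr _)).
Qed.

(** * Solving the quadratic equation for Gamma by successive approximation *)

Variables alpha beta : VM -> VM.
Hypotheses (alphaP : derivation_map alpha) (betaP : even_map beta).
Hypothesis alpha_beta : forall m, alpha (beta m) = beta (alpha m).
Hypothesis ext : ext_vanishes (piB piA) piP actP (koszul_diff alpha beta) 2.

Let al : rlinear alpha. Proof. by case: alphaP. Qed.
Let bl : rlinear beta. Proof. by case: betaP. Qed.

(* G solves  beta = [alpha, G] + t G^2  modulo t^n, with t^n b the error. *)
Definition approx_sol n (G b : VM -> VM) : Prop :=
  [/\ odd_map G, even_map b,
      (forall m, beta m - alpha (G m) - G (alpha m) - t *: G (G m) = t ^+ n *: b m) &
      (forall m, alpha (b m) + t *: G (b m) = b (alpha m + t *: G m))].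

Lemma approx_sol0 : approx_sol 0 (fun=> 0) beta.
Proof.
split=> //.
- split=> [c u v|n m|a m]; first by rewrite scaler0 addr0.
    by rewrite (rlin0 (pi_lin grM _)).
  by rewrite (rlin0 (actr _)).
- by move=> m; rewrite (rlin0 al) scaler0 !subr0 scale1r.
- by move=> m; rewrite !scaler0 !addr0 alpha_beta.
Qed.

(** Shearing by G turns (alpha, beta) into (alpha', t^n b), and b commutes with both entries, so Ext
    vanishing applies to b. Of the two equations obtained, the first gives the new error and the
    second its commutation with the new alpha, with no cancellation of t. *)
Lemma approx_solS n G b : approx_sol n G b -> exists g b',
  odd_map g /\ approx_sol n.+1 (fun m => G m + t ^+ n *: g m) b'.
Proof.
move=> [oG eb bE com]; have [Gl Gd Ga] := oG; have [lb bd ba] := eb.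
pose alpha' m := alpha m + t *: G m; pose beta' m := t ^+ n *: b m.
have iso : dg_iso piP actP (koszul_diff alpha beta) piP actP (koszul_diff alpha' beta')
    (fun v => (v.1, v.2 - G v.1)).
  by apply: shear_iso => // m; rewrite /beta' -bE.
have [|||m|g [d [og ed bE' xE]]] := ext_vanishes_components _ _ (ext_vanishes_iso iso ext) eb _ _.
- exact: derivation_map_addZ.
- exact: even_mapZ.
- exact: com.
- by rewrite /beta' (rlinZ lb).
have [gl gd ga] := og; have [dl dd da] := ed.
exists g, (fun m => d m - t ^+ n *: g (g m)); split=> //; split.
- exact: odd_map_addZ.
- exact: even_map_subZ_sqr.
(* The old error equation is put in the form 0 = left side - t^n b; the goal, moved to one side, is
   then a rearrangement of it. *)
- move=> m; have := bE m => /(congr1 (fun v => beta m - alpha (G m) - G (alpha m) - t *: G (G m) - v)).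
  rewrite subrr bE'=> e.
  rewrite !(rlinE al, rlinE Gl, rlinE gl).
  apply/eqP; rewrite -subr_eq0; apply/eqP; rewrite [RHS]e /alpha' !(rlinE gl).
  by lmod.
(* Substituting b = alpha' g + g alpha' + t d into t^n (b g - g b) = alpha' d - d alpha' gives the
   commutator of alpha' with d - t^n g^2 as t^(n+1) (d g - g d), which the correction t^(n+1) g of
   alpha' cancels. *)
- move=> m; have := xE m; rewrite /beta' /alpha' => /eqP; rewrite subr_eq => /eqP e.
  have := bE' m; rewrite /alpha' => e1.
  have := bE' (g m); rewrite /alpha' => e2.
  move: e; rewrite e2 !(rlinE gl) e1 !(rlinE gl, rlinE dl, rlinE al, rlinE Gl).
  move=> /(congr1 (@tv _ _)) e.
  apply: tv_inj; apply/eqP; rewrite -subr_eq0; apply/eqP.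
  move/eqP: e; rewrite -subr_eq0 => /eqP e; rewrite -[RHS]oppr0 -[in RHS]e ?exprS !tvE; ring.
Qed.

Hypothesis sep : t_separated t VM.
Hypothesis compl : forall i, t_complete_on t (homog piM i).

(** Limits exist on each homogeneous component, where the increments lie in a single M_i, hence on
    finite sums. Uniqueness of limits passes linearity, degree and semilinearity to Gamma. *)
Lemma odd_maps_limit (G g : nat -> VM -> VM) :
  (forall n, odd_map (G n)) -> (forall n, odd_map (g n)) ->
  (forall n m, G n.+1 m = G n m + t ^+ n *: g n m) ->
  exists2 Gamma, odd_map Gamma & forall m, t_limit t (G^~ m) (Gamma m).
Proof.
move=> oG og GS.
have lim m : exists l, t_limit t (G^~ m) l.
  have [s ->] := pi_sum grM m; elim: s => [|i s [l IHs]].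
    exists 0 => n; exists 0; have [Gl _ _] := oG n.
    by rewrite big_nil (rlin0 Gl) subrr scaler0.
  have [n||l' lP] := compl (i := i + (- 1)) (u := fun n => G n (piM i m))
    (w := fun n => g n (piM i m)).
  - have [_ gd _] := og n.
    by rewrite /homog -gd (homog_pi grM).
  - by move=> n; rewrite GS.
  exists (1 *: l' + l) => n; have [z e] := t_limitD 1 lP IHs n; exists z.
  have [Gl _ _] := oG n.
  by rewrite big_cons (rlinD Gl) -[G n (piM i m)]scale1r.
have [Gamma GP] := functional_choice _ lim.
have uniq_lim m l : t_limit t (G^~ m) l -> Gamma m = l.
  exact: t_limit_unique.
exists Gamma => //; split.
- move=> c u v; apply: uniq_lim => n.
  have [z e] := t_limitD c (GP u) (GP v) n; exists z.
  by have [-> _ _] := oG n.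
- move=> i m; apply: uniq_lim => n.
  have [z e] := t_limit_lin (pi_lin grM (i + (- 1))) (GP m) n; exists z.
  by have [_ -> _] := oG n.
- move=> a m; apply: uniq_lim => n.
  have [z e] := t_limit_lin (actr (sigA a)) (GP m) n; exists z.
  by have [_ _ ->] := oG n.
Qed.

(** Replacing Gamma by G_n changes the equation by a multiple of t^n, and G_n solves it up to t^n
    b_n; so the defect of Gamma is divisible by every t^n and vanishes by separatedness. *)
Lemma exists_solution : exists2 Gamma, odd_map Gamma &
  forall m, beta m = alpha (Gamma m) + Gamma (alpha m) + t *: Gamma (Gamma m).
Proof.
have [u uP] := @dependent_choice_seq ((VM -> VM) * (VM -> VM))
  (fun n x => approx_sol n x.1 x.2)
  (fun n x y => exists2 g, odd_map g & forall m, y.1 m = x.1 m + t ^+ n *: g m)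
  (fun=> 0, beta) approx_sol0
  (fun n x xP => let: ex_intro g (ex_intro b' (conj og bP)) := approx_solS xP in
     ex_intro _ (_, b') (conj (ex_intro2 _ _ g og (fun=> erefl)) bP)).
have [g gP] := functional_choice (fun n g => odd_map g /\
    forall m, (u n.+1).1 m = (u n).1 m + t ^+ n *: g m)
  (fun n => let: conj _ (ex_intro2 g og e) := uP n in ex_intro _ g (conj og e)).
have [|||Gamma oG GP] := @odd_maps_limit (fun n => (u n).1) g.
- by move=> n; case: (uP n) => [[]].
- by move=> n; case: (gP n).
- by move=> n m; case: (gP n).
exists Gamma => // m; apply/eqP; rewrite -subr_eq0; apply/eqP/sep => n.
have [[_ _ /(_ m) bE _] _] := uP n; have [Gl _ _] := oG.
set Gn := (u n).1 in bE *; set bn := (u n).2 in bE.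
have [z1 e1] := GP m n; have [z2 e2] := GP (alpha m) n.
(* The quadratic term needs convergence at the moving point G_n m as well; the inner G_n m is then
   replaced through linearity of Gamma. *)
have [z3 e3] := GP (Gn m) n.
have E1 : Gn m = Gamma m - t ^+ n *: z1 by rewrite -e1 subKr.
have E2 : Gn (alpha m) = Gamma (alpha m) - t ^+ n *: z2 by rewrite -e2 subKr.
have E3 : Gn (Gn m) = Gamma (Gn m) - t ^+ n *: z3 by rewrite -e3 subKr.
exists (bn m - alpha z1 - z2 - t *: z3 - t *: Gamma z1).
rewrite E3 E2 E1 !(rlinE al, rlinE Gl) in bE.
apply/eqP; rewrite -subr_eq0; apply/eqP; move/eqP: bE; rewrite -subr_eq0 => /eqP bE.
by rewrite -[RHS]bE; lmod.
Qed.
End KoszulMaps.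

(** * Completeness of semi-free modules *)

Section Spans.
Variables (R : comPzRingType) (V : lmodType R).

(** Coefficients are split off one generator at a time, which suits the induction on s in the
    completeness proof. *)
Fixpoint rspan (s : seq V) (v : V) : Prop :=
  if s is x :: s' then exists r w, rspan s' w /\ v = r *: x + w else v = 0.

Lemma rspan0 s : rspan s 0.
Proof.
by elim: s => //= x s IHs; exists 0, 0; rewrite scale0r addr0.
Qed.

Lemma rspan_lincomb s a u v : rspan s u -> rspan s v -> rspan s (a *: u + v).
Proof.
elim: s u v => [|x s IHs] u v /=; first by move=> -> ->; rewrite scaler0 addr0.
move=> [r [w [sw ->]]] [r' [w' [sw' ->]]]; exists (a * r + r'), (a *: w + w').
by split; [apply: IHs | rewrite scalerDl; lmod].
Qed.

Lemma rspanD s u v : rspan s u -> rspan s v -> rspan s (u + v).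
Proof. by move=> su sv; rewrite -[u]scale1r; apply: rspan_lincomb. Qed.

Lemma rspanZ s a u : rspan s u -> rspan s (a *: u).
Proof. by move=> su; rewrite -[_ *: _]addr0; apply: rspan_lincomb => //; apply: rspan0. Qed.

Lemma rspan_mem s x : x \in s -> rspan s x.
Proof.
elim: s => //= y s IHs; rewrite inE => /orP[/eqP->|xs].
  by exists 1, 0; rewrite scale1r addr0; split=> //; apply: rspan0.
by exists 0, x; rewrite scale0r add0r; split=> //; apply: IHs.
Qed.

Lemma rspan_sum (I : eqType) (s : seq V) (q : seq I) (F : I -> V) :
  (forall i, i \in q -> rspan s (F i)) -> rspan s (\sum_(i <- q) F i).
Proof.
move=> sF; rewrite big_seq; apply: big_ind => //; first exact: rspan0.
by move=> u v; apply: rspanD.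
Qed.
End Spans.

Lemma rspan_map (R : comPzRingType) (V W : lmodType R) (f : V -> W) s s' v :
  rlinear f -> (forall x, x \in s -> rspan s' (f x)) -> rspan s v -> rspan s' (f v).
Proof.
move=> fl; elim: s v => [|x s IHs] v /= sf; first by move->; rewrite (rlin0 fl); apply: rspan0.
move=> [r [w [sw ->]]]; rewrite fl; apply: rspan_lincomb; first by apply: sf; rewrite mem_head.
by apply: IHs => // y ys; apply: sf; rewrite inE ys orbT.
Qed.

Lemma free_finite_rank_rspan (R : comPzRingType) (V : lmodType R) (P : V -> Prop) :
  free_finite_rank P ->
  exists s : seq V, (forall x, x \in s -> P x) /\ forall v, P v -> rspan s v.
Proof.
move=> [s [sP [gen _]]]; exists s; split=> [x /(nthP 0)[k ks <-]|v /gen[c ->]]; first exact: sP.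
apply: rspan_sum => k _; apply: rspanZ; apply: rspan_mem; exact: mem_nth.
Qed.

Section Completeness.
Variables (R : comPzRingType) (t : R).
Hypothesis Rt : t_adically_complete t.

(** The increments are expanded in the generators, and each coefficient series, the sum of the t^k
    r_k, is summed in R by completeness. *)
Lemma t_complete_on_rspan (V : lmodType R) (P : V -> Prop) s :
  (forall v, P v -> rspan s v) -> t_complete_on t P.
Proof.
move=> Ps u w Pw uS.
have [l lP] : exists l, t_limit t (fun n => \sum_(k < n) t ^+ k *: w k) l.
  have {Pw} : forall n, rspan s (w n) by move=> n; apply: Ps.
  elim: s w {Ps uS} => [|x s IHs] w sw.
    exists 0 => n; exists 0; rewrite scaler0 big1 ?subr0 // => k _.
    by rewrite sw scaler0.
  have [r rP] := functional_choice _ sw.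
  have [w' wP] := functional_choice _ rP.
  have [l lP] := IHs w' (fun n => let: conj h _ := wP n in h).
  have [_ /(_ (fun n => \sum_(k < n) t ^+ k * r k))[|rho rhoP]] := Rt.
    by move=> n; exists (r n); rewrite big_ord_recr /= addrAC subrr add0r.
  exists (rho *: x + l) => n; have [z e] := lP n; have [z' e'] := rhoP n.
  exists (z' *: x + z); rewrite scalerDr -e scalerA -e' scalerBl scaler_suml.
  have -> : \sum_(k < n) t ^+ k *: w k =
      \sum_(k < n) (t ^+ k * r k) *: x + \sum_(k < n) t ^+ k *: w' k.
    rewrite -big_split; apply: eq_bigr => k _.
    by have [_ ->] := wP k; rewrite scalerDr scalerA.
  by lmod.
exists (u 0%N + l) => n; have [z e] := lP n; exists z; rewrite -e.
have -> : u n = u 0%N + \sum_(k < n) t ^+ k *: w k.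
  elim: n {e} => [|n IHn]; first by rewrite big_ord0 addr0.
  by rewrite uS IHn big_ord_recr addrA.
by lmod.
Qed.

(** Comparing coefficients in a finite basis of each degree shows that every coefficient is
    divisible by all t^n, hence zero. *)
Lemma t_separated_free_pieces (V : lmodType R) (pi : int -> V -> V) :
  grading pi -> (forall i, free_finite_rank (homog pi i)) -> t_separated t V.
Proof.
move=> gr free v vt; apply: (pi_eq0 gr) => i.
have [s [_ [gen indep]]] := free i.
have [c cE] := gen _ (homog_pi gr i v).
rewrite cE big1 // => k _; have [sep _] := Rt; rewrite [c k]sep ?scale0r // => n.
have [z vE] := vt n; have [d dE] := gen _ (homog_pi gr i z).
exists (d k); apply/eqP; rewrite -subr_eq0; apply/eqP.
apply: (indep (fun k => c k - t ^+ n * d k)) => //.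
under eq_bigr do rewrite scalerBl -scalerA.
by rewrite sumrB -cE -scaler_sumr -dE vE (rlinZ (pi_lin gr i)) subrr.
Qed.
End Completeness.

(** Repeated indices are collected and c' is zero outside s, so two expansions can later be compared
    over one common duplicate-free list. *)
Lemma sum_supported (R : comPzRingType) (V W : lmodType R) (J : eqType)
  (f : J -> V -> W) (s : seq J) (c : J -> V) : (forall j, rlinear (f j)) ->
  exists c' : J -> V, forall s', uniq s' -> {subset s <= s'} ->
    \sum_(j <- s) f j (c j) = \sum_(j <- s') f j (c' j).
Proof.
move=> fl; elim: s => [|i s [c' IHs]].
  by exists (fun=> 0) => s' _ _; rewrite big_nil big1 // => j _; rewrite (rlin0 (fl j)).
exists (fun j => (if j == i then c i else 0) + c' j) => s' us ss.
have is' : i \in s' by apply: ss; rewrite mem_head.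
rewrite big_cons (IHs s') // => [|j js]; last by apply: ss; rewrite inE js orbT.
under [RHS]eq_bigr do rewrite (rlinD (fl _)).
rewrite big_split /= [X in _ = X + _](bigD1_seq i) //= eqxx.
by rewrite [X in _ + X + _]big1 ?addr0 // => j /negbTE->; rewrite (rlin0 (fl j)).
Qed.

Section SemibasisModule.
Variables (R : comPzRingType) (t : R) (VA : lmodType R) (piA : int -> VA -> VA).
Variables (mulA : VA -> VA -> VA) (oneA : VA) (dA : VA -> VA).
Hypothesis Rt : t_adically_complete t.
Hypothesis dga : is_dga piA mulA oneA dA.
Hypothesis freeA : forall i : int, free_finite_rank (homog piA i).
Variables (VM : lmodType R) (piM : int -> VM -> VM) (act : VA -> VM -> VM).
Hypothesis gm : is_gmod piA mulA oneA piM act.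
Variables (J : eqType) (e : J -> VM) (deg : J -> int).
Hypothesis sb : semibasis piM act e deg.

Let grA := dga_grading dga.
Let grM := gmod_grading gm.
Let actl m := act_linl gm m.

Lemma semibasis_indep (s : seq J) (c : J -> VA) :
  uniq s -> \sum_(j <- s) act (c j) (e j) = 0 -> forall j, j \in s -> c j = 0.
Proof.
case: sb => ei _ _ indep us /indep h j js.
by have /allP/(_ j js)/eqP : all (fun j => c j == 0) s by apply: h; rewrite map_inj_uniq.
Qed.

(** If v = t^n z, independence over a common list gives c_j = t^n d_j in A for the coefficients;
    this holds for all n, and A is separated. *)
Lemma semibasis_separated : t_separated t VM.
Proof.
move=> v vt; have [_ _ gen _] := sb.
have ext m : exists (s : seq J) (c : J -> VA), forall s', uniq s' -> {subset s <= s'} ->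
    m = \sum_(j <- s') act (c j) (e j).
  have [s [c ->]] := gen m; exists s.
  exact: (@sum_supported _ _ _ _ (fun j a => act a (e j)) s c (fun j => actl (e j))).
have [s [c cP]] := ext v.
rewrite (cP (undup s)) ?undup_uniq // => [|j]; last by rewrite mem_undup.
rewrite big_seq big1 // => j; rewrite mem_undup => js.
rewrite (_ : c j = 0) ?(rlin0 (actl _)) //.
apply: (t_separated_free_pieces Rt grA freeA) => n.
have [z vE] := vt n; have [s' [d dP]] := ext z; exists (d j).
pose q := undup (s ++ s'); have uq : uniq q := undup_uniq _.
apply/eqP; rewrite -subr_eq0; apply/eqP.
apply: (semibasis_indep (s := q) (c := fun j => c j - t ^+ n *: d j)) => //; last first.
  by rewrite mem_undup mem_cat js.
under eq_bigr do rewrite (rlinD (actl _)) (rlinN (actl _)) (rlinZ (actl _)).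
rewrite sumrB -cP // => [|i si]; last by rewrite mem_undup mem_cat si.
rewrite -scaler_sumr -dP ?vE ?subrr // => i si.
by rewrite mem_undup mem_cat si orbT.
Qed.

Hypothesis bdd : bounded_below piM.
Hypothesis degfin : forall n : int, exists s : seq VM, forall j, deg j = n -> e j \in s.

(** As A lives in nonnegative degrees and M is bounded below, only basis elements with n0 <= deg j
    <= i contribute to M_i. There are finitely many in each degree, and each A_k is finitely
    generated over R. *)
Lemma semibasis_piece_rspan i : exists s, forall v, homog piM i v -> rspan s v.
Proof.
have spans (K : nat) : exists s, forall j a (k : nat), (k < K)%N -> deg j = i - k%:Z ->
    homog piA k%:Z a -> rspan s (act a (e j)).
  elim: K => [|K [s IHs]]; first by exists [::].
  have [q qP] := degfin (i - K%:Z).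
  have [b [_ bspan]] := free_finite_rank_rspan (freeA K%:Z).
  exists (s ++ [seq act x y | x <- b, y <- q]) => j a k.
  rewrite ltnS leq_eqVlt => /orP[/eqP->|kK] dj ha.
    apply: (rspan_map (f := act^~ (e j)) (s := b)) (bspan _ ha) => // x xb.
    apply: rspan_mem; rewrite mem_cat; apply/orP; right.
    by apply: allpairs_f => //; apply: qP.
  apply: (rspan_map (f := id)) (IHs j a k kK dj ha) => // x xs.
  by apply: rspan_mem; rewrite mem_cat xs.
have [n0 bn0] := bdd; have [_ he gen _] := sb.
(* A contributing coefficient has degree k = i - deg j <= i - n0; the successor accounts for the
   strict bound in [spans]. *)
have [s sP] := spans (absz (i - n0)).+1; exists s => v hv.
have [q [c vE]] := gen v.
rewrite -hv vE (rlin_sum (pi_lin grM i)).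
apply: rspan_sum => j _; rewrite (pi_act grA gm i (c j) (he j)).
have [neg|pos] := ltP (i - deg j) 0.
  have [_ [-> // _]] := dga.
  by rewrite (rlin0 (actl _)); apply: rspan0.
have [low|high] := ltP (deg j) n0.
  by rewrite -(he j) bn0 // (rlin0 (act_linr gm _)); apply: rspan0.
apply: (sP j _ (absz (i - deg j))); [lia|lia|].
by rewrite gez0_abs //; apply: homog_pi.
Qed.

Lemma semibasis_complete i : t_complete_on t (homog piM i).
Proof.
have [s sP] := semibasis_piece_rspan i; exact: (t_complete_on_rspan Rt sP).
Qed.
End SemibasisModule.

(** * Splitting N as M + xM *)

Section FixedSpace.
Variables (R : comPzRingType) (V : lmodType R) (p : V -> V).

(** The span M will become a module as the fixed space of the projection of N onto it. The linearity
    proof is a parameter so that the algebraic instances can depend on it. *)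
Definition fixed_pred (_ : rlinear p) : pred V := fun v => p v == v.

Lemma fixed_submod_closed pl : submod_closed (fixed_pred pl).
Proof.
split=> [|a u v]; rewrite !unfold_in /fixed_pred; first by rewrite (rlin0 pl).
by move=> /eqP pu /eqP pv; rewrite pl pu pv.
Qed.
HB.instance Definition _ pl :=
  GRing.isSubmodClosed.Build R V (fixed_pred pl) (fixed_submod_closed pl).

Inductive fixed_space (pl : rlinear p) : predArgType :=
  FixedVec v & v \in fixed_pred pl.

Definition fixed_val pl (w : fixed_space pl) : V := let: FixedVec v _ := w in v.
HB.instance Definition _ pl := [isSub of fixed_space pl for @fixed_val pl].
HB.instance Definition _ pl := [Choice of fixed_space pl by <:].
HB.instance Definition _ pl := [SubChoice_isSubZmodule of fixed_space pl by <:].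
HB.instance Definition _ pl := [SubZmodule_isSubLmodule of fixed_space pl by <:].

Lemma fixed_val_lin pl : rlinear (@fixed_val pl). Proof. by []. Qed.
Lemma fixed_val_inj pl : injective (@fixed_val pl). Proof. exact: val_inj. Qed.

Lemma fixed_valP pl w : p (@fixed_val pl w) = fixed_val w.
Proof. by case: w => v /= /eqP. Qed.
End FixedSpace.

Section Splitting.
Variables (R : comPzRingType) (t : R) (VA : lmodType R) (piA : int -> VA -> VA).
Variables (mulA : VA -> VA -> VA) (oneA : VA) (dA sigA : VA -> VA).
Hypotheses (dga : is_dga piA mulA oneA dA) (sgA : is_sign_op piA sigA).
Variables (VN : lmodType R) (piN : int -> VN -> VN) (actN : VA * VA -> VN -> VN).
Hypothesis gmN : is_gmod (piB piA) (mulB mulA sigA) (oneB oneA) piN actN.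
Variables (J : eqType) (e : J -> VN) (deg : J -> int).
Hypothesis sb : semibasis piN actN e deg.

Let grA := dga_grading dga.
Let grN := gmod_grading gmN.
Let act0 a v := actN (a, 0) v.
Let X v := actN (0, oneA) v.

Let mul0r := dga_mul0r dga.
Let mul0l := dga_mul0l dga.
Let sig0 : sigA 0 = 0. Proof. exact: rlin0 (sign_lin sgA). Qed.

Lemma restrict_gmod : is_gmod piA mulA oneA piN act0.
Proof.
split=> //.
- move=> r a a' m; rewrite -(act_linl gmN m r (a, 0) (a', 0)).
  by congr (actN (_, _) _); rewrite /= scaler0 addr0.
- by move=> r a; apply: (act_linr gmN).
- move=> a b m; rewrite /act0 -(act_mul gmN); congr (actN (_, _) _) => /=.
  by rewrite mul0r mul0l addr0.
split=> [m|i j a m ha]; first exact: (act_one gmN).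
exact/(act_homog gmN)/(homog_inl dga).
Qed.

Lemma X_act0 a v : X (act0 a v) = actN (0, a) v.
Proof.
rewrite /X /act0 -(act_mul gmN) /mulB /=.
by rewrite mul0l sig0 mul0l (dga_mul1l dga) add0r.
Qed.

Lemma act0_X a v : act0 a (X v) = X (act0 (sigA a) v).
Proof.
rewrite X_act0 /X /act0 -(act_mul gmN) /mulB /=.
by rewrite mul0l mul0r (dga_mul1r dga) addr0.
Qed.

Lemma XX v : X (X v) = 0.
Proof.
rewrite /X -(act_mul gmN) /mulB /= sig0 mul0l mul0l mul0r addr0.
exact: (rlin0 (act_linl gmN v)).
Qed.

Lemma X_lin : rlinear X. Proof. exact: act_linr gmN _. Qed.

Lemma pi_X n v : piN n (X v) = X (piN (n - 1) v).
Proof.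
apply: (grading_ext grN (f := piN n \o X) (g := X \o piN (n - 1))).
- exact: rlinear_comp (pi_lin grN _) X_lin.
- exact: rlinear_comp X_lin (pi_lin grN _).
move=> i u hu /=; rewrite (pi_homog grN _ hu).
rewrite (pi_homog grN n (act_homog gmN (homog_x dga) hu)) (addrC 1) -subr_eq.
by case: eqP => // _; rewrite (rlin0 X_lin).
Qed.

Lemma actN_split b v : actN b v = act0 b.1 v + X (act0 b.2 v).
Proof.
rewrite X_act0 -(rlinD (act_linl gmN v)); congr (actN _ _).
by case: b => b0 b1; congr (_, _); rewrite /= ?addr0 ?add0r.
Qed.

Let act0_linl v := act_linl restrict_gmod v.

Definition in_span (v : VN) : Prop :=
  exists (s : seq J) (c : J -> VA), v = \sum_(j <- s) act0 (c j) (e j).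

Lemma in_span_supported v : in_span v -> exists (s : seq J) (c : J -> VA),
  forall s', uniq s' -> {subset s <= s'} -> v = \sum_(j <- s') act0 (c j) (e j).
Proof.
move=> [s [c ->]]; exists s.
by apply: (@sum_supported _ _ _ _ (fun j a => act0 a (e j)) s c) => j; apply: act0_linl.
Qed.

Lemma in_span_common u v : in_span u -> in_span v ->
  exists (s : seq J) (c d : J -> VA), [/\ uniq s,
    u = \sum_(j <- s) act0 (c j) (e j) & v = \sum_(j <- s) act0 (d j) (e j)].
Proof.
move=> /in_span_supported[s [c cP]] /in_span_supported[s' [d dP]].
exists (undup (s ++ s')), c, d; rewrite undup_uniq; split=> //.
  by apply: cP => [|j js]; rewrite ?undup_uniq // mem_undup mem_cat js.
by apply: dP => [|j js]; rewrite ?undup_uniq // mem_undup mem_cat js orbT.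
Qed.

Lemma in_span_lincomb a u v : in_span u -> in_span v -> in_span (a *: u + v).
Proof.
move=> su /(in_span_common su)[s [c [d [_ -> ->]]]].
exists s, (fun j => a *: c j + d j); rewrite scaler_sumr -big_split.
by apply: eq_bigr => j _; rewrite (act0_linl (e j)).
Qed.

Lemma in_span_act a v : in_span v -> in_span (act0 a v).
Proof.
move=> [s [c ->]]; exists s, (fun j => mulA a (c j)).
rewrite (rlin_sum (act_linr restrict_gmod a)).
by apply: eq_bigr => j _; rewrite (act_mul restrict_gmod).
Qed.

Lemma in_span_pi n v : in_span v -> in_span (piN n v).
Proof.
move=> [s [c ->]]; exists s, (fun j => piA (n - deg j) (c j)).
rewrite (rlin_sum (pi_lin grN n)); apply: eq_bigr => j _.
by case: sb => _ he _ _; rewrite (pi_act grA restrict_gmod n (c j) (he j)).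
Qed.

Lemma in_span_basis j : in_span (e j).
Proof.
exists [:: j], (fun=> oneA); rewrite big_seq1; symmetry; exact: (act_one restrict_gmod).
Qed.

Lemma splitting_exists v : exists mm : VN * VN,
  [/\ in_span mm.1, in_span mm.2 & v = mm.1 + X mm.2].
Proof.
case: sb => _ _ /(_ v)[s [c ->]] _.
exists (\sum_(j <- s) act0 (c j).1 (e j), \sum_(j <- s) act0 (c j).2 (e j)) => /=.
split; [by exists s, (fst \o c) | by exists s, (snd \o c) |].
by rewrite (rlin_sum X_lin) -big_split; apply: eq_bigr => j _; apply: actN_split.
Qed.

(** The difference of two splittings is a B-combination of the semi-basis with coefficients c_j + x
    d_j, so independence over B kills the c_j and the d_j together. *)
Lemma splitting_unique u v u' v' : in_span u -> in_span v -> in_span u' -> in_span v' ->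
  u + X v = u' + X v' -> u = u' /\ v = v'.
Proof.
move=> su sv su' sv' eq_uv.
have sub x y : in_span x -> in_span y -> in_span (x - y).
  by move=> sx sy; rewrite addrC -scaleN1r; apply: in_span_lincomb.
have [s [c [d [us uE vE]]]] := in_span_common (sub _ _ su su') (sub _ _ sv sv').
have dz : \sum_(j <- s) actN (c j, d j) (e j) = 0.
  under eq_bigr do rewrite actN_split.
  rewrite big_split -(rlin_sum X_lin) -uE -vE (rlinD X_lin) (rlinN X_lin).
  by rewrite /= addrACA eq_uv -opprD subrr.
have cd0 j : j \in s -> (c j, d j) = (0, 0).
  exact: (semibasis_indep (c := fun j => (c j, d j)) sb us dz).
split; apply/eqP; rewrite -subr_eq0; apply/eqP; rewrite ?uE ?vE big_seq big1 // => j /cd0.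
  by case=> -> _; apply: (rlin0 (act0_linl _)).
by case=> _ ->; apply: (rlin0 (act0_linl _)).
Qed.

(** M is realised as the fixed space of the first component p of the splitting v = p v + x (q v),
    and [phi] is v |-> (p v, q v). Its compatibilities all come from uniqueness of the splitting. *)
Lemma splitting : exists (VM : lmodType R) (piM : int -> VM -> VM) (act : VA -> VM -> VM) (eM : J -> VM)
  (phi : VN -> VM * VM) (psi : VM * VM -> VN),
  [/\ is_gmod piA mulA oneA piM act, semibasis piM act eM deg,
      forall j, (phi (e j)).1 = eM j,
      cancel phi psi /\ cancel psi phi &
      [/\ rlinear phi, of_degree piN (piBM piM) 0 phi &
          forall b v, phi (actN b v) = actBM sigA act b (phi v)]].
Proof.
have [mm mmP] := functional_choice _ splitting_exists.
pose p v := (mm v).1; pose q v := (mm v).2.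
have sp v : in_span (p v) by case: (mmP v).
have sq v : in_span (q v) by case: (mmP v).
have pqE v : v = p v + X (q v) by case: (mmP v).
have pq_unique v m0 m1 : in_span m0 -> in_span m1 -> v = m0 + X m1 -> p v = m0 /\ q v = m1.
  by move=> s0 s1 vE; apply: splitting_unique => //; rewrite -pqE.
have pq_lin a u v : p (a *: u + v) = a *: p u + p v /\ q (a *: u + v) = a *: q u + q v.
  apply: pq_unique; [exact: in_span_lincomb | exact: in_span_lincomb |].
  by rewrite {1}[u]pqE {1}[v]pqE X_lin; lmod.
have pl : rlinear p by move=> a u v; case: (pq_lin a u v).
have ql : rlinear q by move=> a u v; case: (pq_lin a u v).
have span0 : in_span 0 by rewrite -(rlin0 pl).
have span_fixed v : in_span v -> v \in fixed_pred pl.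
  move=> sv; apply/eqP; have [|pE _ //] := @pq_unique v v 0 sv span0.
  by rewrite (rlin0 X_lin) addr0.
pose VM : lmodType R := fixed_space pl.
pose iota : VM -> VN := @fixed_val _ _ _ pl.
have iota_inj : injective iota by apply: fixed_val_inj.
have iota_lin : rlinear iota by apply: fixed_val_lin.
have spi w : in_span (iota w) by rewrite /iota -fixed_valP.
pose mk v (sv : in_span v) : VM := FixedVec (span_fixed v sv).
have mkK v sv : iota (@mk v sv) = v by [].
pose piM n w := mk _ (in_span_pi n (spi w)).
pose act a w := mk _ (in_span_act a (spi w)).
pose phi v := (mk _ (sp v), mk _ (sq v)).
pose psi (w : VM * VM) := iota w.1 + X (iota w.2).
have gN := restrict_gmod.
exists VM, piM, act, (fun j => mk _ (in_span_basis j)), phi, psi; split.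
- split.
  + split.
    * by move=> n a u v; apply: iota_inj; rewrite iota_lin !mkK iota_lin (pi_lin grN).
    * move=> n m v; apply: iota_inj; rewrite !mkK (pi_pi grN).
      by case: eqP.
    * move=> v; have [_ _ /(_ (iota v))[s [us vE]]] := grN; exists s; split=> //.
      by apply: iota_inj; rewrite (rlin_sum iota_lin).
  + by move=> r a a' m; apply: iota_inj; rewrite iota_lin !mkK (act_linl gN).
  + by move=> r a m m'; apply: iota_inj; rewrite !(mkK, iota_lin) (act_linr gN).
  + by move=> a b m; apply: iota_inj; rewrite !mkK (act_mul gN).
  + split=> [m|i j a m ha hm]; apply: iota_inj; rewrite !mkK ?(act_one gN) //.
    by apply: (act_homog gN) => //; rewrite /homog -{2}hm.
- have [ei he gen indep] := sb.
  have eM_inj : injective (fun j => mk _ (in_span_basis j)).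
    by move=> j j' /(congr1 iota); apply: ei.
  split=> //.
  + by move=> j; apply: iota_inj; rewrite mkK; apply: he.
  + move=> m; have [s [c mE]] := spi m; exists s, c.
    by apply: iota_inj; rewrite (rlin_sum iota_lin).
  + move=> s c us eq0; apply/allP => j js; apply/eqP.
    (* Independence over A is independence over B for coefficients without x-part. *)
    have /allP/(_ j js)/eqP[] // : all (fun j => (c j, 0 : VA) == 0) s.
    apply: (indep s (fun j => (c j, 0))).
      by move: us; rewrite !map_inj_uniq //; apply: eM_inj.
    by have := congr1 iota eq0; rewrite (rlin_sum iota_lin).
- move=> j; apply: iota_inj; rewrite !mkK.
  have [|pE _ //] := pq_unique (e j) _ _ (in_span_basis j) span0.
  by rewrite (rlin0 X_lin) addr0.
- split=> [v|[m0 m1]]; first by rewrite /psi !mkK -pqE.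
  have [pE qE] := @pq_unique (psi (m0, m1)) _ _ (spi m0) (spi m1) erefl.
  by congr (_, _); apply: iota_inj; rewrite mkK.
- split.
  + move=> a u v; congr (_, _); apply: iota_inj; rewrite iota_lin !mkK; [exact: pl|exact: ql].
  + move=> n v; rewrite addr0.
    have [|pE qE] := pq_unique (piN n v) _ _ (in_span_pi n (sp v))
      (in_span_pi (n - 1) (sq v)).
      by rewrite {1}[v]pqE (rlinD (pi_lin grN n)) pi_X.
    by congr (_, _); apply: iota_inj; rewrite !mkK.
  + move=> b v; have [|||pE qE] := pq_unique (actN b v) (act0 b.1 (p v))
      (act0 (sigA b.1) (q v) + act0 b.2 (p v)).
    * exact: in_span_act.
    * by rewrite -[act0 (sigA _) _]scale1r; apply: in_span_lincomb; apply: in_span_act.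
    * rewrite {1}[v]pqE actN_split !(rlinD (act_linr gN _)) !act0_X !(rlinD X_lin) XX.
      by lmod.
    by congr (_, _); apply: iota_inj; rewrite ?(rlinD iota_lin) !mkK.
Qed.
End Splitting.

(** The Leibniz rule for elements of A gives the laws of alpha and beta, and for x, with dx = t, it
    gives D(x m) = t m - x D(m). The remaining relations are the two components of D^2 = 0 on M. *)
Lemma koszul_diff_components (R : comPzRingType) (t : R) (VA : lmodType R)
  (piA : int -> VA -> VA) (mulA : VA -> VA -> VA) (oneA : VA) (dA sigA : VA -> VA)
  (VM : lmodType R) (piM : int -> VM -> VM) (act : VA -> VM -> VM) (D : VM * VM -> VM * VM) :
  is_dga piA mulA oneA dA -> is_sign_op piA sigA -> is_gmod piA mulA oneA piM act ->
  rlinear D -> of_degree (piBM piM) (piBM piM) (- 1) D -> (forall v, D (D v) = 0) ->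
  (forall i b v, homog (piB piA) i b ->
     D (actBM sigA act b v) =
       actBM sigA act (dB t dA b) v + sgn R i *: actBM sigA act b (D v)) ->
  exists alpha beta, [/\ derivation_map dA sigA piM act alpha, even_map piM act beta,
    (forall m, alpha (beta m) = beta (alpha m)),
    (forall m, alpha (alpha m) + t *: beta m = 0) &
    (forall v, D v = koszul_diff t alpha beta v)].
Proof.
move=> dga sgA gm Dl Dd DD DL; have grA := dga_grading dga; have grM := gmod_grading gm.
have actl := act_linl gm; have actr := act_linr gm.
pose alpha m := (D (m, 0)).1; pose beta m := (D (m, 0)).2.
have abE m : D (m, 0) = (alpha m, beta m) by rewrite /alpha /beta; case: (D _).
have inl_lin : rlinear (fun m : VM => (m, 0 : VM)).
  by move=> c u v; congr (_, _); rewrite /= scaler0 addr0.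
have Dlin : rlinear (fun m => D (m, 0)) := rlinear_comp Dl inl_lin.
have Ddeg n m : D (piM n m, 0) = piBM piM (n + (- 1)) (D (m, 0)).
  by rewrite -Dd /piBM /= (rlin0 (pi_lin grM _)).
have Dact a m : D (act a m, 0) = (act (dA a) m + act (sigA a) (alpha m), act a (beta m)).
  have sl := sign_lin sgA; have dl := dga_dlin dga.
  move: a; apply: (grading_ext grA (f := fun a => D (act a m, 0))
     (g := fun a => (act (dA a) m + act (sigA a) (alpha m), act a (beta m)))).
  - exact: (rlinear_comp Dlin (actl m)).
  - move=> c a a' /=; congr (_, _); last by rewrite /= actl.
    by rewrite /= dl sl !actl; lmod.
  move=> i a ha; have := DL i (a, 0) (m, 0) (homog_inl dga ha).
  rewrite (actBM_inl sigA gm) (rlin0 (actr _)) => ->.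
  rewrite abE (actBM_inl sigA gm) /actBM /dB /= scaler0 addr0 (rlin0 dl) oppr0.
  rewrite (rlin0 (actr _)) !(rlin0 (actl _)) addr0 (sign_homog sgA ha) !(rlinZ (actl _)).
  by congr (_, _); rewrite /= ?add0r ?scalerA ?sgnK ?scale1r.
have al : rlinear alpha by move=> c u v; rewrite /alpha Dlin.
(* The differential of the unit has degree -1, where A is zero. *)
have d1 : dA oneA = 0.
  have [_ [neg _]] := dga.
  by rewrite -(dga_d_homog dga (dga_one dga)) neg.
have DE v : D v = koszul_diff t alpha beta v.
  case: v => m0 m1.
  have -> : (m0, m1) = (m0, 0) + actBM sigA act (0, oneA) (m1, 0).
    by rewrite (actBM_x sgA gm); congr (_, _); rewrite ?addr0 ?add0r.
  rewrite (rlinD Dl) (DL 1 _ _ (homog_x dga)) !abE !(actBM_x sgA gm).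
  rewrite /actBM /dB /koszul_diff /= d1 oppr0 (rlin0 (dga_dlin dga)) add0r.
  rewrite (rlin0 (actr _)) !(rlin0 (actl _)) (rlinZ (actl _)) (act_one gm).
  by congr (_, _); rewrite /= sgn1 scaleN1r (addr0 m0) (add0r m1); lmod.
have DDm m : (alpha (alpha m) + t *: beta m, beta (alpha m) - alpha (beta m)) = 0 :> VM * VM.
  by rewrite -(DD (m, 0)) (abE m) DE.
exists alpha, beta; split=> //.
- split=> // [n m|a m]; first by rewrite /alpha Ddeg.
  by rewrite {1}/alpha Dact.
- split=> [c u v|n m|a m]; first by rewrite /beta Dlin.
    by rewrite /beta Ddeg /piBM /=; congr (piM _ _); lia.
  by rewrite {1}/beta Dact.
- by move=> m; case: (DDm m) => _ /eqP; rewrite subr_eq0 => /eqP.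
- by move=> m; case: (DDm m).
Qed.

Theorem theorem3p4 (R : comPzRingType) (t : R)
  (VA : lmodType R) (piA : int -> VA -> VA) (mulA : VA -> VA -> VA) (oneA : VA)
  (dA : VA -> VA) (sigA : VA -> VA)
  (VN : lmodType R) (piN : int -> VN -> VN) (actN : VA * VA -> VN -> VN) (dN : VN -> VN) :
  noetherian R ->
  t_adically_complete t ->
  is_dga piA mulA oneA dA ->
  (forall i : int, free_finite_rank (homog piA i)) ->
  is_sign_op piA sigA ->
  is_dgmod (piB piA) (mulB mulA sigA) (oneB oneA) (dB t dA) piN actN dN ->
  semifree_degfinite piN actN ->
  ext_vanishes (piB piA) piN actN dN 2 ->
  exists (VM : lmodType R) (piM : int -> VM -> VM) (actM : VA -> VM -> VM) (dM : VM -> VM)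
         (phi : VN -> VM * VM),
    [/\ is_dgmod piA mulA oneA dA piM actM dM,
        semifree piM actM &
        dg_iso piN actN dN (piBM piM) (actBM sigA actM) (dBM t dM) phi].
Proof.
move=> _ Rt dga freeA sgA dgmN [bddN [J [e [deg [sb degfinN]]]]] ext.
have ei : injective e by case: sb.
have [grN [Nl [Nr [NM [N1 [Nh [[dl dd d2] dL]]]]]]] := dgmN.
have gmN : is_gmod (piB piA) (mulB mulA sigA) (oneB oneA) piN actN by split.
(* [inj_type ei] is J with the decidable equality inherited from VN. *)
have [VM [piM [act [eM [phi [psi [gm sbM eME [phiK psiK] [phl phd pha]]]]]]]] :=
  @splitting _ _ _ _ _ _ _ dga sgA _ _ _ gmN (inj_type ei) e deg sb.
pose D := phi \o dN \o psi.
have isoD : dg_iso piN actN dN (piBM piM) (actBM sigA act) D phi.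
  by split=> //; [exists psi | move=> v; rewrite /D /= phiK].
have [psl _ psd psc psa] := dg_iso_inv phiK psiK isoD.
have [|n v|v|i b v hb|alpha [beta [aP bP ab aab DE]]] :=
  @koszul_diff_components _ t _ _ _ _ _ _ _ _ _ D dga sgA gm.
- by apply: rlinear_comp => //; apply: rlinear_comp.
- by rewrite /D /= psd dd phd !addr0.
- by rewrite /D /= phiK d2 (rlin0 phl).
- by rewrite /D /= psa (dL i) // (rlinD phl) (rlinZ phl) !pha psiK.
have extD := ext_vanishes_iso isoD ext.
(* [D] and [koszul_diff] agree only pointwise; the identity as an isomorphism replaces functional
   extensionality. *)
have pD : dg_iso (piBM piM) (actBM sigA act) D (piBM piM) (actBM sigA act)
    (koszul_diff t alpha beta) id.
  by split=> //; [exists id | move=> n v; rewrite addr0].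
have extP := ext_vanishes_iso pD extD.
have bddM : bounded_below piM.
  have [n0 bn0] := bddN; exists n0 => n m nn0.
  have := phd n (psi (m, 0)); rewrite bn0 // (rlin0 phl) psiK addr0.
  by case.
have degfinM n : exists s : seq VM, forall j : inj_type ei, deg j = n -> eM j \in s.
  have [s sP] := degfinN n; exists [seq (phi v).1 | v <- s] => j dj.
  by rewrite -eME; apply: (map_f (fun v => (phi v).1)); apply: sP.
have sepM := semibasis_separated Rt dga freeA gm sbM.
have complM := semibasis_complete Rt dga freeA gm sbM bddM degfinM.
have [Gamma oG GE] := exists_solution dga sgA gm aP bP ab extP sepM complM.
have [al _ _] := aP; have [Gl _ _] := oG.
pose dM m := alpha m + t *: Gamma m.
have dMP : derivation_map dA sigA piM act dM := derivation_map_addZ gm t aP oG.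
(* The equation solved by Gamma says exactly that the sheared beta is zero. *)
have [|sl [rho rhoK Krho] sd sc sa] := @shear_iso _ t _ _ _ _ sigA _ _ _ gm
  alpha beta dM (fun=> 0) Gamma oG (fun=> erefl) al _.
  by move=> m; rewrite GE; lmod.
exists VM, piM, act, dM, (fun v => ((phi v).1, (phi v).2 - Gamma (phi v).1)); split.
- have [grM Ml Mr MM [M1 Mh]] := gm; have [dMl dMd dMa] := dMP.
  do 6![split=> //]; split.
    (* The square of [dM] is alpha^2 + t (alpha Gamma + Gamma alpha + t Gamma^2) = alpha^2 + t beta
       = 0. *)
    split=> // m; rewrite /dM !(rlinE al, rlinE Gl); have := aab m; rewrite GE => aab'.
    by rewrite -[RHS]aab'; lmod.
  by move=> i a m ha; rewrite dMa (sign_homog sgA ha) (rlinZ (act_linl gm _)).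
- by split=> //; exists J, eM, deg.
- split.
  + exact: (rlinear_comp sl phl).
  + exists (psi \o rho) => v /=; last by rewrite psiK Krho.
    by rewrite (rhoK (phi v)) phiK.
  + by move=> n v; rewrite phd (addr0 n) -[n in RHS]addr0; apply: (sd n (phi v)).
  (* With beta = 0 the Koszul differential built from [dM] is the differential of B tensored with M
     over A. *)
  + move=> v; have [_ _ _ phc _] := isoD.
    by rewrite phc DE (sc (phi v)) /koszul_diff /dBM /= sub0r.
  + by move=> b v; rewrite pha (sa b (phi v)).
Qed.
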